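(* Let $q$ be a prime power, and let $m$ and $R$ be positive integers. The following are equivalent. (1) $\mu_q^{\mathrm{sym}}(m)\leq R$. (2) There exist $\alpha_1,\ldots,\alpha_R,\beta_1,\ldots,\beta_R\in\mathbb{F}_{q^m}^*$ such that $\alpha_i/\beta_i\in\mathbb{F}_q$ for every $i\in\{1,\ldots,R\}$, and $$\langle x\rangle_{\mathbb{F}_{q^m}}\subseteq\left\langle \alpha_1\operatorname{Tr}_{q^m/q}(\beta_1 x),\ldots,\alpha_R\operatorname{Tr}_{q^m/q}(\beta_R x)\right\rangle_{\mathbb{F}_q}.$$
   Context: The symmetric tensor rank $\mu_q^{\mathrm{sym}}(m)$ of the multiplication map $M_{q^m}:\mathbb{F}_{q^m}\times\mathbb{F}_{q^m}\to\mathbb{F}_{q^m}$, $(\alpha,\beta)\mapsto\alpha\beta$, is the smallest integer $R$ for which there exist $\mathbb{F}_q$-linear forms $\phi_1,\ldots,\phi_R:\mathbb{F}_{q^m}\to\mathbb{F}_q$ and elements $w_1,\ldots,w_R\in\mathbb{F}_{q^m}$ with $\alpha\beta=\sum_{i=1}^R\phi_i(\alpha)\phi_i(\beta)w_i$ for all $\alpha,\beta\in\mathbb{F}_{q^m}$. $\operatorname{Tr}_{q^m/q}(x)=\sum_{j=0}^{m-1}x^{q^j}$ is the field trace. Linearized polynomials $\sum_{i=0}^{m-1}a_ix^{q^i}$ with $a_i\in\mathbb{F}_{q^m}$ (taken modulo $x^{q^m}-x$) are identified with $\mathbb{F}_q$-linear maps on $\mathbb{F}_{q^m}$; $\langle x\rangle_{\mathbb{F}_{q^m}}=\{ax: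 a\in\mathbb{F}_{q^m}\}$ is regarded as an $\mathbb{F}_q$-subspace of the space of linearized polynomials, and $\langle\cdots\rangle_{\mathbb{F}_q}$ denotes $\mathbb{F}_q$-linear span in that space. *)

(* Defs.v *)
From HB Require Import structures.
From mathcomp Require Import all_boot all_algebra all_field.
From mathcomp Require Import boolp ring.

Set Implicit Arguments.
Unset Strict Implicit.
Unset Printing Implicit Defensive.

Import GRing.Theory.
Local Open Scope ring_scope.

Section SymmetricTensorRank.
Variables (F : fieldType) (L : fieldExtType F).

Definition sym_decomposition (B : L -> L -> L) (R : nat) : Prop :=
  exists (phi : 'I_R -> 'Hom(L, F^o)) (w : 'I_R -> L),
    forall a b : L, B a b = \sum_(i < R) (phi i a * phi i b) *: w i.

Definition mul_sym_decomposition (R : nat) : Prop :=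
  sym_decomposition (fun a b => a * b) R.

Let decomposable B := exists R, sym_decomposition B R.

Lemma decomposable0 : decomposable (fun _ _ => 0).
Proof.
by exists 0%N, (fun=> 0), (fun=> 0) => a b; rewrite big_ord0.
Qed.

Lemma decomposable1 (f : 'Hom(L, F^o)) (c : L) :
  decomposable (fun a b => (f a * f b) *: c).
Proof.
by exists 1%N, (fun=> f), (fun=> c) => a b; rewrite big_ord1.
Qed.

Lemma decomposableD B C : decomposable B -> decomposable C ->
  decomposable (fun a b => B a b + C a b).
Proof.
move=> [R [f [w Bfw]]] [S [g [v Cgv]]].
exists (R + S)%N.
exists (fun i => match split i with inl j => f j | inr j => g j end).
exists (fun i => match split i with inl j => w j | inr j => v j end).
move=> a b; rewrite Bfw Cgv big_split_ord /=.
by congr (_ + _); apply: eq_bigr => i _; rewrite ?(unsplitK (inl i))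
  ?(unsplitK (inr i)).
Qed.

Lemma decomposable_sum (I : Type) (r : seq I) (P : pred I) B :
    (forall i, P i -> decomposable (B i)) ->
  decomposable (fun a b => \sum_(i <- r | P i) B i a b).
Proof.
move=> dB; elim: r => [|i r [R IHr]].
  by have [R] := decomposable0; exists R; under eq2_fun do rewrite big_nil.
have [Pi|nPi] := boolP (P i); last first.
  by exists R; under eq2_fun do rewrite big_cons (negPf nPi).
have [S] := decomposableD (dB i Pi) (ex_intro _ R IHr).
by exists S; under eq2_fun do rewrite big_cons Pi.
Qed.

Lemma mul_sym_decomposition_exists : exists R, `[< mul_sym_decomposition R >].
Proof.
suff [R dR] : decomposable (fun a b => a * b) by exists R; apply/asboolP.
pose n := \dim {:L}; pose e := vbasis {:L}.
pose p i : 'Hom(L, F^o) := linfun (coord e i : L -> F^o).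
pose c i j := e`_i * e`_j.
pose sq (f : 'Hom(L, F^o)) c a b : L := (f a * f b) *: c.
suff -> : (fun a b => a * b) = (fun a b =>
    \sum_(i < n) (sq (p i) (c i i) a b +
      \sum_(j < n | (i < j)%N) (sq (p i + p j) (c i j) a b +
        (sq (p i) (- c i j) a b + sq (p j) (- c i j) a b)))).
  apply: decomposable_sum => i _; apply: decomposableD.
    exact: decomposable1.
  apply: decomposable_sum => j _; apply: decomposableD.
    exact: decomposable1.
  by apply: decomposableD; apply: decomposable1.
apply/funext => a; apply/funext => b.
have pE i x : p i x = coord e i x by rewrite lfunE.
pose t i j : L := (coord e i a * coord e j b) *: c i j.
transitivity (\sum_(i < n) \sum_(j < n) t i j).
  rewrite {1}(coord_vbasis (memvf a)) {1}(coord_vbasis (memvf b)) mulr_suml.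
  apply: eq_bigr => i _; rewrite mulr_sumr; apply: eq_bigr => j _.
  by rewrite -scalerAl -scalerAr scalerA.
transitivity (\sum_(i < n) (t i i + \sum_(j < n | (i < j)%N) (t i j + t j i))).
  rewrite big_split /=.
  under [X in _ + X]eq_bigr do rewrite big_split /=.
  rewrite big_split /= addrA.
  rewrite [X in _ + X](exchange_big_dep predT) //= -!big_split /=.
  apply: eq_bigr => i _; rewrite (bigD1 i) //= -addrA; congr (_ + _).
  rewrite (bigID (fun j : 'I_n => (i < j)%N)) /=; congr (_ + _);
    by apply: eq_bigl => j; rewrite -val_eqE /=; case: ltngtP.
apply: eq_bigr => i _; rewrite /sq; congr (_ + _); first by rewrite !pE.
apply: eq_bigr => j _; rewrite !add_lfunE !pE /t [c j i]mulrC -/(c i j).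
rewrite !scalerN -!scaleNr -!scalerDl; congr (_ *: _).
have sqD (x y z u : F) : x * u + y * z = (x + y) * (z + u) + (- x * z + - y * u).
  by ring.
exact: sqD.
Qed.

Definition mu_sym : nat := ex_minn mul_sym_decomposition_exists.

Lemma mu_symP : mul_sym_decomposition mu_sym /\
  forall R, mul_sym_decomposition R -> (mu_sym <= R)%N.
Proof.
rewrite /mu_sym; case: ex_minnP => R /asboolP dR minR.
by split=> // S dS; apply/minR/asboolP.
Qed.

End SymmetricTensorRank.

Section TraceMaps.
Variables (F : finFieldType) (L : fieldExtType F).

Definition frob_trace (q m : nat) (x : L) : L := \sum_(j < m) x ^+ (q ^ j).

(* The linearized polynomial alpha Tr(beta x), taken modulo x^(q^m) - x, as an
   F-linear endomorphism of L. [linfun] is only meaningful on linear functions: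
   when q = #|F| the function below is linear, see [scaled_traceE]. *)
Definition scaled_trace (q m : nat) (alpha beta : L) : 'End(L) :=
  linfun (fun x => alpha * frob_trace q m (beta * x)).

Lemma frob_trace_is_linear (q m : nat) (a b : L) :
  #|F| = q -> linear (fun x => a * frob_trace q m (b * x)).
Proof.
move=> hq k x y; rewrite /frob_trace scalerAr scaler_sumr -mulrDr -big_split /=.
congr (_ * _); apply: eq_bigr => j _.
have [p p_pr pchF] := finPcharP F.
have pnat_q : [pchar L].-nat (q ^ j)%N.
  have pchL : p \in [pchar L] by rewrite pchar_lalg.
  by rewrite pnatX (eq_pnat _ (pcharf_eq pchL)) -hq (card_pprimeChar pchF)
    pnatX pnat_id.
have Fq : k ^+ (q ^ j) = k.
  by elim: (j : nat) => [|i IHi]; rewrite ?expr1 // expnSr exprM IHi -hq expf_card.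
by rewrite mulrDr exprDn_pchar // -scalerAr exprZn Fq.
Qed.

Lemma scaled_traceE (q m : nat) (a b x : L) :
  #|F| = q -> scaled_trace q m a b x = a * frob_trace q m (b * x).
Proof.
move=> hq; pose lin := GRing.isLinear.Build F L L *:%R
  (fun x => a * frob_trace q m (b * x)) (frob_trace_is_linear m a b hq).
pose f : {linear L -> L} := HB.pack (fun x => a * frob_trace q m (b * x)) lin.
exact: (lfunE f).
Qed.

(* The F-subspace {a x : a in L}, see [scalar_mapsP]. *)
Definition scalar_maps : {vspace 'End(L)} := limg (linfun (@amull F L)).

Lemma scalar_mapsP (f : 'End(L)) :
  reflect (exists a : L, forall x, f x = a * x) (f \in scalar_maps).
Proof.
apply: (iffP memv_imgP) => [[a _ ->]|[a fE]].
  by exists a => x; rewrite !lfunE.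
by exists a; rewrite ?memvf //; apply/lfunP => x; rewrite fE !lfunE.
Qed.

End TraceMaps.

(* Main.v *)
Require Import Defs.
From mathcomp Require Import all_boot all_algebra all_field.
From HB Require Import structures.

(** Write [T] for the trace of [L] over [F], as an [F]-linear form on [L].  The
    form [T (x * y)] is symmetric and nondegenerate, so every linear form on [L]
    is [T (b * _)] for some [b] ([trace_form_onto]), and an identity in [L] may
    be tested by multiplying by an arbitrary element and applying [T].

    A symmetric decomposition of the product therefore has the shape
<<
      x y = sum_i T(b_i x) T(b_i y) w_i,
>>
    and testing it against [a] turns it into the trilinear identity
<<
      T(a x y) = sum_i T(a w_i) T(b_i x) T(b_i y).
>>
    Reading the latter as an identity between linear forms in [y], instead of in
    [a], gives
<<
      a x = sum_i T(a w_i) b_i T(b_i x),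
>>
    which says that multiplication by each [a] is an [F]-combination of the maps
    [b_i T(b_i x)].  This is [mul_decomposition_duality].  In the converse
    direction the coefficients of multiplication by [a] can be chosen linear in
    [a], hence of the form [T (a * w_i)], and the constants [alpha_i / beta_i],
    which lie in [F], are absorbed into them. *)

Import GRing.Theory.
Local Open Scope ring_scope.

Lemma amullE (K : fieldType) (A : falgType K) (a x : A) : amull a x = a * x.
Proof. exact: lfunE. Qed.

Section TraceForm.
Variables (F : finFieldType) (L : fieldExtType F).

Local Notation q := #|F|.
Local Notation m := (\dim {:L}).

Lemma pchar_nat_card : [pchar L].-nat q.
Proof.
have [p p_pr pchF] := finPcharP F.
have pchL : p \in [pchar L] by rewrite pchar_lalg.
by rewrite (eq_pnat _ (pcharf_eq pchL)) (card_pprimeChar pchF) pnatX pnat_id.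
Qed.

Lemma expr_card_ext (x : L) : x ^+ (q ^ m) = x.
Proof. by apply/eqP; rewrite -(Fermat's_little_theorem {:L}%AS) memvf. Qed.

(** The [q]-th power map permutes the summands [x ^+ (q ^ j)] cyclically, and
    its fixed points are the elements of [F]. *)
Lemma frob_trace_in_base (x : L) : frob_trace q m x \in 1%VS.
Proof.
rewrite (Fermat's_little_theorem 1%AS) dimv1 expn1 /frob_trace.
have exprqD y z := exprDn_pchar y z pchar_nat_card.
have expr0q : (0 : L) ^+ q = 0.
  by rewrite expr0n -leqn0 leqNgt (ltnW (finNzRing_gt1 F)).
rewrite (big_morph (fun y : L => y ^+ q) exprqD expr0q).
move: (expr_card_ext x); rewrite -(prednK (adim_gt0 {:L}%AS)) => xq.
rewrite big_ord_recr big_ord_recl /= expn0 expr1 -exprM -expnSr xq addrC.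
by apply/eqP; congr (_ + _); apply: eq_bigr => j _; rewrite -exprM -expnSr.
Qed.

(** The trace is a nonzero polynomial function of degree at most [q ^ m.-1],
    which is less than the number of elements of [L]. *)
Lemma frob_trace_neq0 : exists x : L, frob_trace q m x != 0.
Proof.
pose P : {poly L} := \sum_(j < m) 'X^(q ^ j).
have PE x : P.[x] = frob_trace q m x.
  by rewrite /P horner_sum; apply: eq_bigr => j _; rewrite hornerXn.
have q_gt1 : (1 < q)%N := finNzRing_gt1 F.
have m_gt0 : (0 < m)%N := adim_gt0 {:L}%AS.
have P_neq0 : P != 0.
  (* only the summand with [j = 0] contributes to the coefficient of 'X *)
  apply/eqP => /(congr1 (fun p : {poly L} => p`_1)) /eqP.
  rewrite coef0 coef_sum (bigD1 (Ordinal m_gt0)) //= coefXn expn0 eqxx.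
  rewrite big1 ?addr0 ?oner_eq0 // => j j_neq0.
  rewrite coefXn -(expn0 q) eqn_exp2l // eq_sym.
  by rewrite -[0%N]/(val (Ordinal m_gt0)) val_eqE (negPf j_neq0).
have P_size : (size P <= (q ^ m.-1).+1)%N.
  apply: (leq_trans (size_sum _ _ _)); apply/bigmax_leqP => j _.
  by rewrite size_polyXn ltnS leq_pexp2l ?(ltnW q_gt1) // -ltnS prednK.
pose fL := finvect_type L.
have size_L : size (enum fL) = (q ^ m)%N.
  transitivity #|(fullv : {vspace fL})|; last exact: card_vspace.
  by rewrite -cardE; apply: eq_card => x; rewrite memvf.
case: (boolP (all (root P) (enum fL))) => [allP | /allPn[x _ nPx]]; last first.
  by exists x; rewrite -PE.
have := leq_trans (max_poly_roots P_neq0 allP (enum_uniq _)) P_size.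
by rewrite size_L ltnS leq_exp2l // -ltnS prednK // ltnn.
Qed.

(** The trace, read through the identification of the line [1%VS] with [F]. *)
Definition trace_form : 'Hom(L, F^o) :=
  (linfun (coord [tuple (1 : L)] ord0 : L -> F^o) \o scaled_trace q m 1 1)%VF.

Local Notation T := trace_form.

Lemma trace_formE (x : L) : (T x)%:A = frob_trace q m x.
Proof.
rewrite comp_lfunE lfunE /= (scaled_traceE _ _ _ _ (erefl q)) !mul1r.
have tr_span : frob_trace q m x \in <<[tuple (1%R : L)]>>%VS.
  by rewrite span_seq1 frob_trace_in_base.
by rewrite [RHS](coord_span tr_span) big_ord1.
Qed.

Lemma scaled_trace_formE (a b x : L) :
  scaled_trace q m a b x = T (b * x) *: a.
Proof. by rewrite (scaled_traceE _ _ _ _ (erefl q)) -trace_formE mulr_algr. Qed.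

Lemma trace_form_nondegenerate (x : L) : (forall y, T (x * y) = 0) -> x = 0.
Proof.
move=> Tx0; apply/eqP/negPn/negP => x_neq0.
have [y /negP[]] := frob_trace_neq0.
by rewrite -trace_formE -(mulVKf x_neq0 y) Tx0 scale0r.
Qed.

Lemma trace_form_inj (x y : L) : (forall z, T (x * z) = T (y * z)) -> x = y.
Proof.
move=> Txy; apply/eqP; rewrite -subr_eq0; apply/eqP.
by apply: trace_form_nondegenerate => z; rewrite mulrBl linearB /= Txy subrr.
Qed.

(** By nondegeneracy [b |-> T (b * _)] is an injection of [L] into its dual, and
    the two spaces have the same dimension. *)
Lemma trace_form_onto (phi : 'Hom(L, F^o)) :
  exists b : L, forall x, phi x = T (b * x).
Proof.
have D_lin : linear (fun b : L => (T \o amull b)%VF).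
  by move=> k a b; rewrite linearP /= comp_lfunDr comp_lfunZr.
pose DL : {linear L -> 'Hom(L, F^o)} :=
  HB.pack (fun b : L => (T \o amull b)%VF) (GRing.isLinear.Build F _ _ *:%R _ D_lin).
pose D := linfun DL.
have DE b x : D b x = T (b * x).
  by rewrite lfunE comp_lfunE amullE.
have kerD : (fullv :&: lker D = 0)%VS.
  apply/eqP; rewrite capfv -subv0; apply/subvP => b.
  rewrite memv_ker memv0 => /eqP Db0; apply/eqP.
  by apply: trace_form_nondegenerate => x; rewrite -DE Db0 lfunE.
have /memv_imgP[b _ ->] : phi \in limg D.
  suff -> : limg D = fullv by apply: memvf.
  by apply/eqP; rewrite eqEdim subvf (limg_dim_eq kerD) !dimvf /dim /= muln1.
by exists b => x; rewrite DE.
Qed.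

(** Both sides say that [T (a * x * y)] is the sum of
    [T (a * w i) * T (b i * x) * T (b i * y)], tested against [a] on the left and
    against [y] on the right. *)
Lemma mul_decomposition_duality (R : nat) (b w : 'I_R -> L) :
  (forall x y, x * y = \sum_(i < R) (T (b i * x) * T (b i * y)) *: w i) <->
  (forall a x, a * x = \sum_(i < R) T (a * w i) *: (T (b i * x) *: b i)).
Proof.
have TE c (u : 'I_R -> L) z :
    T ((\sum_(i < R) c i *: u i) * z) = \sum_(i < R) c i * T (u i * z).
  by rewrite mulr_suml linear_sum; apply: eq_bigr => i _; rewrite -scalerAl linearZ.
split=> dec x y; apply: trace_form_inj => z.
- under [X in _ = T (X * _)]eq_bigr do rewrite scalerA.
  rewrite -mulrA [x * (y * z)]mulrC (dec y z) !TE; apply: eq_bigr => i _.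
  by rewrite [w i * x]mulrC [LHS]mulrC mulrA.
- rewrite [x * y * z]mulrC mulrA (dec z x).
  under [X in T (X * y)]eq_bigr do rewrite scalerA.
  rewrite !TE; apply: eq_bigr => i _.
  by rewrite [w i * z]mulrC [RHS]mulrC mulrA.
Qed.

Lemma mul_sym_decomposition_trace (R : nat) :
  mul_sym_decomposition L R <->
  exists b w : 'I_R -> L,
    forall x y, x * y = \sum_(i < R) (T (b i * x) * T (b i * y)) *: w i.
Proof.
split=> [[phi [w dec]] | [b [w dec]]].
- have [b bE] := fin_all_exists (fun i => trace_form_onto (phi i)).
  by exists b, w => x y; rewrite dec; apply: eq_bigr => i _; rewrite !bE.
- exists (fun i => (T \o amull (b i))%VF), w => x y.
  by rewrite dec; apply: eq_bigr => i _; rewrite !comp_lfunE !amullE.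
Qed.

End TraceForm.

Lemma mul_sym_decomposition_leq (F : fieldType) (L : fieldExtType F) (r R : nat) :
  (r <= R)%N -> mul_sym_decomposition L r -> mul_sym_decomposition L R.
Proof.
move=> /subnKC <- [phi [w dec]].
exists (fun i => if split i is inl j then phi j else 0).
exists (fun i => if split i is inl j then w j else 0) => x y.
rewrite dec big_split_ord /= [X in _ + X]big1 ?addr0 => [|i _].
  by apply: eq_bigr => i _; rewrite (unsplitK (inl i)).
by rewrite (unsplitK (inr i)) scaler0.
Qed.

Lemma mu_sym_leqP (F : fieldType) (L : fieldExtType F) (R : nat) :
  (mu_sym L <= R)%N <-> mul_sym_decomposition L R.
Proof.
have [dec min] := mu_symP L.
by split=> [le_mu|/min//]; apply: mul_sym_decomposition_leq le_mu dec.
Qed.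

Theorem proposition2p7 (q m R : nat) (m_gt0 : (0 < m)%N) (R_gt0 : (0 < R)%N)
    (F : finFieldType) (L : fieldExtType F)
    (card_F : #|F| = q) (dim_L : \dim {:L} = m) :
  (mu_sym L <= R)%N <->
  exists alpha beta : 'I_R -> L,
    [/\ forall i, alpha i != 0 /\ beta i != 0,
        forall i, alpha i / beta i \in 1%VS
      & (scalar_maps L <=
           <<[seq scaled_trace q m (alpha i) (beta i) | i : 'I_R]>>)%VS].
Proof.
rewrite mu_sym_leqP mul_sym_decomposition_trace; subst q m.
split=> [[b [w /mul_decomposition_duality dec]] | [al [be [nz al_be sub]]]].
- (* A vanishing [b i] contributes nothing, so it may be replaced by 1. *)
  pose b' i := if b i == 0 then 1 else b i.
  have b'_neq0 i : b' i != 0 by rewrite /b'; case: ifPn => // _; apply: oner_neq0.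
  exists b', b'; split=> // [i|]; first by rewrite divff // mem1v.
  apply/subvP => f /scalar_mapsP[a fE].
  pose u i := scaled_trace #|F| (\dim {:L}) (b' i) (b' i).
  have -> : f = \sum_(i < R) (if b i == 0 then 0 else trace_form F L (a * w i)) *: u i.
    apply/lfunP => x; rewrite fE dec sum_lfunE; apply: eq_bigr => i _.
    rewrite scale_lfunE scaled_trace_formE /b'.
    by case: ifPn => [/eqP->|_]; rewrite ?scale0r ?scaler0.
  apply: memv_suml => i _; apply/memvZ/memv_span.
  by apply: map_f; rewrite mem_enum.
- pose X := [tuple of [seq scaled_trace #|F| (\dim {:L}) (al i) (be i) | i <- ord_tuple R]].
  have XE (i : 'I_R) : X`_i = scaled_trace #|F| (\dim {:L}) (al i) (be i).
    by rewrite -tnth_nth tnth_map tnth_ord_tuple.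
  have X_span a : amull a \in <<X>>%VS.
    by apply: (subvP sub); apply/scalar_mapsP; exists a => x; apply: amullE.
  have /fin_all_exists[c cE] (i : 'I_R) : exists k : F, al i = k *: be i.
    have /vlineP[k kE] := al_be i; exists k.
    by rewrite -(divfK (proj2 (nz i)) (al i)) kE mulr_algl.
  (* [coord X i] is linear on all of 'End(L) even when the tuple X is not free,
     so the coefficients of multiplication by a are linear forms in a. *)
  pose coef i : 'Hom(L, F^o) :=
    c i *: (linfun (coord X i : 'End(L) -> F^o) \o linfun (@amull F L))%VF.
  have coefE i a : coef i a = c i * coord X i (amull a).
    rewrite scale_lfunE comp_lfunE lfunE /=.
    by congr (_ * coord X i _); apply: lfunE.
  have [w wE] := fin_all_exists (fun i => trace_form_onto F L (coef i)).
  exists be, w; apply/mul_decomposition_duality => a x.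
  rewrite -amullE (coord_span (X_span a)) sum_lfunE; apply: eq_bigr => i _.
  rewrite scale_lfunE XE scaled_trace_formE cE [a * _]mulrC -wE coefE.
  by rewrite !scalerA mulrAC [c i * _]mulrC.
Qed.
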